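(* Let $p$ be an odd prime and let $n=2^\nu p^r n'$, where $\nu>0$ and $r\geq 0$ are integers and $n'$ is an odd positive integer with $p\nmid n'$. Let $l$ be a positive integer. Then the number $NH(p^{2l},n)$ of Hermitian self-dual negacyclic codes of length $n$ over $\mathbb{F}_{p^{2l}}$ is \[ NH(p^{2l},n)=\begin{cases}(p^r+1)^{\frac{1}{2}\sum_{d\mid n'}\frac{\phi(d2^{\nu+1})}{\operatorname{ord}_{d2^{\nu+1}}(p^{2l})}} & \text{if } 2^{\nu+1}\nmid (p^l+1),\\ 0 & \text{otherwise.}\end{cases} \]
   Context: A linear code of length $n$ over $\mathbb{F}_{p^{2l}}$ is an $\mathbb{F}_{p^{2l}}$-subspace of $\mathbb{F}_{p^{2l}}^n$. It is negacyclic if $(-c_{n-1},c_0,\dots,c_{n-2})\in C$ whenever $(c_0,\dots,c_{n-1})\in C$. The Hermitian dual of $C$ is $C^{\perp_H}=\{v\in\mathbb{F}_{p^{2l}}^n : \sum_{i=1}^n v_ic_i^{p^l}=0 \text{ for all } c\in C\}$, and $C$ is Hermitian self-dual if $C=C^{\perp_H}$. $\phi$ is Euler's totient function and $\operatorname{ord}_m(x)$ is the multiplicative order of $x$ modulo $m$. *)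

(* Defs.v *)
From HB Require Import structures.
From mathcomp Require Import all_boot all_order all_algebra all_field.
Set Implicit Arguments. Unset Strict Implicit. Unset Printing Implicit Defensive.
Import GRing.Theory.
Local Open Scope ring_scope.

Section Codes.
Variables (F : finFieldType) (n : nat).

(* coordinate k (0-based) of a row vector, 0 if out of range *)
Definition vcoord (c : 'rV[F]_n) (k : nat) : F :=
  oapp (fun j : 'I_n => c 0 j) 0 (insub k).

Definition negashift (c : 'rV[F]_n) : 'rV[F]_n :=
  \row_(i < n) (if (i : nat) == 0%N then - vcoord c n.-1 else vcoord c i.-1).

Definition is_linear_code (C : {set 'rV[F]_n}) : bool :=
  [&& 0 \in C,
      [forall u in C, forall v in C, (u + v) \in C] &
      [forall a : F, forall u in C, (a *: u) \in C]].

Definition is_negacyclic (C : {set 'rV[F]_n}) : bool :=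
  [forall c in C, negashift c \in C].

(* Hermitian dual w.r.t. the conjugation x |-> x^q (q = p^l) *)
Definition herm_dual (q : nat) (C : {set 'rV[F]_n}) : {set 'rV[F]_n} :=
  [set v : 'rV[F]_n | [forall c in C, \sum_(i < n) v 0 i * (c 0 i) ^+ q == 0]].

Definition herm_self_dual (q : nat) (C : {set 'rV[F]_n}) : bool :=
  C == herm_dual q C.

Definition NH (q : nat) : nat :=
  #|[set C : {set 'rV[F]_n} |
      [&& is_linear_code C, is_negacyclic C & herm_self_dual q C]]|.

End Codes.

(* multiplicative order of x modulo m: least k in 1..m with x^k = 1 mod m
   (for coprime x, m >= 1 the order is <= m, so this is ord_m(x)) *)
Definition ordm (m x : nat) : nat :=
  head 0%N [seq k <- iota 1 m | (x ^ k == 1 %[mod m])%N].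

(* Main.v *)
Require Import Defs.
From HB Require Import structures.
From mathcomp Require Import all_boot all_order all_algebra all_field.
From mathcomp Require Import cyclic zify.
Set Implicit Arguments.
Unset Strict Implicit.
Unset Printing Implicit Defensive.
Import GRing.Theory.

(* Write q = p^l, P = p^r and n0 = 2^nu * n', and let R be the set of the n0
   roots of X^n0 + 1 in an algebraic closure of F. Linear negacyclic codes are
   the sets of multiples of the divisors g of M = X^n + 1 = (X^n0 + 1)^P, and
   the Hermitian dual of the code of g is generated by M / g*, with g* the
   conjugate reciprocal of g, whose roots are the z^(-q) for z a root of g. So g
   is given by its root multiplicities m : R -> [0, P], and its code is self-dual
   iff m x + m (s x) = P for all x, where s x = x^(-q). As s (s x) = x^(q^2),
   this condition already forces m to be invariant under the Frobenius map, that
   is, g to have its coefficients in F. Hence there are (P + 1)^k such codes if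
   all k orbits of s on R have even length, and none if s has an orbit of odd
   length, since P is odd. An orbit of odd length j through x means that the
   order of x divides q^j + 1; this order is a multiple of 2^(nu+1), and
   (q^j + 1) / (q + 1) is odd, so such orbits exist iff 2^(nu+1) divides q + 1.
   Otherwise the roots of order e = d * 2^(nu+1), for d dividing n', split into
   orbits of length 2 * ord_e(q^2). *)

Local Open Scope ring_scope.

(** * Functions alternating between a value and its complement along orbits *)

Section AlternatingColourings.
Variables (T : finType) (s : T -> T) (P : nat).
Hypotheses (s_inj : injective s) (s_even : forall x, ~~ odd (order s x)).

Let par x := odd (findex s (froot s x) x).

Let froot_s x : froot s (s x) = froot s x.
Proof.
apply/esym/eqP; rewrite root_connect; first exact: fconnect1.
exact: fconnect_sym.
Qed.

(** Inside an orbit the distance from the root grows by one. At the last point it falls from the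
    orbit length minus one, which is odd as the length is even, back to zero. *)
Let par_s x : par (s x) = ~~ par x.
Proof.
rewrite /par froot_s; set r := froot s x.
have rx : fconnect s r x.
  by rewrite fconnect_sym //; apply: connect_root.
have lt_i := findex_max rx; have Di := iter_findex rx.
set i := findex s r x in lt_i Di *.
have [lt_i1|ge_i1] := ltnP i.+1 (order s r).
  by rewrite -Di -iterS findex_iter.
have o_i1 : order s r = i.+1 by apply/eqP; rewrite eqn_leq ge_i1 lt_i.
rewrite -Di -iterS -o_i1 iter_order // findex0 /=.
by have := s_even r; rewrite o_i1 /= => /negPf->.
Qed.

Let rep := {x : T | froots s x}.

Let rep_of x : rep := Sub (froot s x) (roots_root (fconnect_sym s_inj) x).

Let ext (v : {ffun rep -> 'I_P.+1}) : {ffun T -> 'I_P.+1} :=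
  [ffun x => if par x then rev_ord (v (rep_of x)) else v (rep_of x)].

(** On each orbit the value at the root determines all others: [P] minus it at odd distance, the
    value itself at even distance. Any choice at the roots extends by [ext], since [par] alternates
    around the whole cycle. *)
Lemma card_alternating_ffun :
  #|[set m : {ffun T -> 'I_P.+1} | [forall x, m x + m (s x) == P :> nat]%N]|
  = (P.+1 ^ fcard s T)%N.
Proof.
have par_rep (t : rep) : par (val t) = false.
  by rewrite /par (eqP (valP t)) findex0.
have rep_ofK (t : rep) : rep_of (val t) = t.
  by apply: val_inj; rewrite /= (eqP (valP t)).
have ext_inj : injective ext.
  move=> v w /ffunP vw; apply/ffunP => t; have := vw (val t).
  by rewrite !ffunE par_rep rep_ofK.
have -> : fcard s T = #|{: rep}|.
  by rewrite card_sig; apply: eq_card => x; rewrite !inE andbT.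
rewrite -[P.+1 in RHS]card_ord -card_ffun -cardsT -(card_imset _ ext_inj).
apply: eq_card => m; rewrite inE; apply/forallP/imsetP => [alt_m|[v _ ->] x].
  exists [ffun t => m (val t)]; first by rewrite inE.
  have iterE k x : m (iter k s x) = if odd k then rev_ord (m x) else m x.
    elim: k => //= k IHk; apply: val_inj; move/eqP: (alt_m (iter k s x)).
    move=> /(congr1 (subn^~ (m (iter k s x)))); rewrite addKn IHk /= => ->.
    by case: (odd k); rewrite //= !subSS subKn // -ltnS.
  apply/ffunP => x; rewrite !ffunE /=.
  rewrite -[x in LHS](@iter_findex _ s (froot s x)) ?iterE //.
  by rewrite fconnect_sym //; apply: connect_root.
rewrite !ffunE par_s; have -> : rep_of (s x) = rep_of x.
  by apply: val_inj; rewrite /= froot_s.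
by case: (par x); rewrite /= subSS (subnK, subnKC) // -ltnS.
Qed.

End AlternatingColourings.

(** * Conjugate reciprocal polynomials *)

Section ConjugateReciprocal.
Variables (F : fieldType) (q : nat).
Hypothesis q_char : [pchar F].-nat q.

(** For [p] of degree at most [d] this is X^d * p^(q)(1/X), with p^(q) the coefficientwise [q]-th
    power. Fixing [d] independently of [p] makes it additive, which [crecip] is not. *)
Definition crev d (p : {poly F}) : {poly F} :=
  \poly_(i < d.+1) p`_(d - i) ^+ q.

Definition crecip (p : {poly F}) := crev (size p).-1 p.

Let q_gt0 : (0 < q)%N. Proof. by case/andP: q_char. Qed.

Let exprq0 : 0 ^+ q = 0 :> F.
Proof. by rewrite expr0n gtn_eqF. Qed.

Lemma crevD d p1 p2 : crev d (p1 + p2) = crev d p1 + crev d p2.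
Proof.
apply/polyP => i; rewrite coefD !coef_poly; case: ifP; last by rewrite addr0.
by rewrite coefD exprDn_pchar.
Qed.

Lemma crevZ d c p : crev d (c *: p) = c ^+ q *: crev d p.
Proof.
apply/polyP => i; rewrite coefZ !coef_poly; case: ifP; last by rewrite mulr0.
by rewrite coefZ exprMn.
Qed.

Lemma crev0 d : crev d 0 = 0.
Proof. by apply/polyP => i; rewrite coef_poly !coef0 exprq0 if_same. Qed.

Lemma crevMX d p : crev d.+1 (p * 'X) = crev d p.
Proof.
apply/polyP => i; rewrite !coef_poly coefMX subn_eq0.
have [le_id|] := ltnP i d.+1; first by rewrite ltnW ?subSn //= leqNgt le_id.
by rewrite exprq0 if_same.
Qed.

Lemma crev_shift k d (p : {poly F}) : (size p <= d.+1)%N ->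
  crev (k + d) p = 'X^k * crev d p.
Proof.
move=> sz_p; apply/polyP => i; rewrite coefXnM !coef_poly.
have [lt_ik|le_ki] := ltnP i k.
  rewrite nth_default ?exprq0 ?if_same //.
  rewrite (leq_trans sz_p) // addnC -addnBA ?(ltnW lt_ik) //.
  by rewrite -[d.+1]addn1 leq_add2l subn_gt0.
by rewrite -addnS -ltn_subLR // subnBA // [(d + k)%N]addnC.
Qed.

Lemma crevC d c : crev d c%:P = c ^+ q *: 'X^d.
Proof.
apply/polyP => i; rewrite coefZ coefXn coef_poly coefC subn_eq0 ltnS.
by case: ltngtP => _; rewrite ?mulr0 ?mulr1 ?exprq0.
Qed.

Lemma crevXn d : crev d 'X^d = 1.
Proof.
elim: d => [|d IHd]; first by rewrite crevC expr1n scale1r.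
by rewrite exprSr crevMX.
Qed.

(** By additivity, [p1] splits into a multiple of X and a constant: the first is handled by the
    induction hypothesis through [crevMX], the second by [crev_shift]. *)
Lemma crevM d e (p1 p2 : {poly F}) :
  (size p1 <= d.+1)%N -> (size p2 <= e.+1)%N ->
  crev (d + e) (p1 * p2) = crev d p1 * crev e p2.
Proof.
elim: d p1 => [|d IHd] p1 sz_p1 sz_p2.
  by rewrite (size1_polyC sz_p1) mul_polyC crevZ crevC expr0 -scalerAl mul1r.
elim/poly_ind: p1 sz_p1 => [|p1 c _] sz_p1; first by rewrite mul0r !crev0 mul0r.
have sz_p1' : (size p1 <= d.+1)%N.
  move: sz_p1; rewrite size_MXaddC; case: ifP => // /andP[/eqP-> _].
  by rewrite size_poly0.
rewrite mulrDl mulrAC !crevD addSn !crevMX IHd // mulrDl; congr (_ + _).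
by rewrite mul_polyC crevZ -addSn crev_shift // scalerAl crevC.
Qed.

Lemma crecip1 : crecip 1 = 1.
Proof. by rewrite /crecip size_poly1 crevC expr1n scale1r. Qed.

Lemma crecipM : {morph crecip : p1 p2 / p1 * p2}.
Proof.
move=> p1 p2; rewrite /crecip; have [->|p1_neq0] := eqVneq p1 0.
  by rewrite mul0r !crev0 mul0r.
have [->|p2_neq0] := eqVneq p2 0; first by rewrite mulr0 !crev0 mulr0.
rewrite -crevM ?leqSpred // size_mul //.
move: p1_neq0 p2_neq0; rewrite -!size_poly_gt0.
by case: (size p1) => // a; case: (size p2) => // b; rewrite addSn addnS.
Qed.

Lemma crecip_XsubC a : crecip ('X - a%:P) = 1 - (a ^+ q) *: 'X.
Proof.
apply/polyP => i; rewrite coef_poly size_XsubC !coefB coefZ !coefX !coefC.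
case: i => [|[|i]] //=.
  by rewrite subr0 mulr0 subr0 expr1n.
  by rewrite !sub0r mulr1 exprNn_pchar.
by rewrite mulr0 subr0.
Qed.

Lemma size_crecip (p : {poly F}) : p`_0 != 0 -> size (crecip p) = size p.
Proof.
move=> p0; have sz_p : (0 < size p)%N.
  by rewrite lt0n size_poly_eq0; apply: contraNneq p0 => ->; rewrite coef0.
by rewrite /crecip -[RHS](prednK sz_p) size_poly_eq //= subnn expf_neq0.
Qed.

Lemma crecip_Xn_add1 n : (0 < n)%N -> crecip ('X^n + 1) = 'X^n + 1.
Proof.
move=> n_gt0; rewrite /crecip size_XnaddC //= crevD crevC expr1n scale1r addrC.
by rewrite crevXn.
Qed.

End ConjugateReciprocal.

Lemma map_crecip (F K : fieldType) (f : {rmorphism F -> K}) q p :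
  map_poly f (crecip q p) = crecip q (map_poly f p).
Proof.
apply/polyP => i; rewrite coef_map /crecip size_map_poly 2!coef_poly /= coef_map.
by case: ifP => _; rewrite ?rmorphXn ?rmorph0.
Qed.

(** * Negacyclic codes as ideals modulo X^n + 1, and their Hermitian duals *)

Section PolynomialCodes.
Variables (F : finFieldType) (n : nat).
Hypothesis n_gt0 : (0 < n)%N.

Local Notation M := ('X^n + 1 : {poly F}).

Let size_M : size M = n.+1. Proof. by rewrite size_XnaddC. Qed.
Let M_neq0 : M != 0. Proof. by rewrite -size_poly_eq0 size_M. Qed.

Definition polycode (g : {poly F}) : {set 'rV[F]_n} :=
  [set v | g %| rVpoly v].

Let size_rVpoly (v : 'rV[F]_n) : (size (rVpoly v) <= n)%N.
Proof. exact: size_poly. Qed.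

Let size_modM (p : {poly F}) : (size (p %% M)%R <= n)%N.
Proof. by rewrite -ltnS -size_M ltn_modp. Qed.

Lemma rVpoly_negashift (v : 'rV[F]_n) :
  rVpoly (negashift v) = 'X * rVpoly v %% M.
Proof.
have sz_v := size_rVpoly v.
have vcoordE k : vcoord v k = (rVpoly v)`_k.
  by rewrite coef_rVpoly /vcoord; case: insubP.
(* The quotient is the top coefficient of [v]: it multiplies X^n, which is -1 modulo [M]. *)
apply: (@modpP _ _ ((rVpoly v)`_n.-1)%:P); last by rewrite size_M ltnS.
apply/polyP => i; rewrite coefXM coefD coefCM coefD coefXn coef1.
have [lt_in|le_ni] := ltnP i n.
  have -> : i = Ordinal lt_in :> nat by [].
  rewrite coef_rVpoly_ord mxE !vcoordE (ltn_eqF lt_in) add0r /=.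
  by case: (i == 0)%N; rewrite ?mulr0 ?add0r // mulr1 subrr.
rewrite [(rVpoly _)`_i]nth_default ?(leq_trans (size_rVpoly _)) //.
have /negPf-> : i != 0%N by rewrite -lt0n (leq_trans n_gt0).
rewrite !addr0; case: eqP => [->|/eqP ne_in]; first by rewrite mulr1.
rewrite mulr0 nth_default // (leq_trans sz_v) //.
by rewrite -ltnS prednK ?(leq_trans n_gt0) // ltn_neqAle eq_sym ne_in.
Qed.

Lemma polycode_linear g : is_linear_code (polycode g).
Proof.
apply/and3P; split; first by rewrite inE linear0 dvdp0.
  apply/forall_inP => u; rewrite inE => gu; apply/forall_inP => v.
  by rewrite !inE => gv; rewrite linearD dvdp_add.
apply/forallP => a; apply/forall_inP => u; rewrite !inE => gu.
by rewrite linearZ /= -mul_polyC dvdp_mull.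
Qed.

Lemma polycode_negacyclic g : g %| M -> is_negacyclic (polycode g).
Proof.
move=> gM; apply/forall_inP => v; rewrite !inE => gv.
by rewrite rVpoly_negashift -dvdp_mod // dvdp_mull.
Qed.

Lemma polycode_sub g h : g %| M ->
  polycode g \subset polycode h -> h %| M -> h %| g.
Proof.
(* The reduction matters when [g] has degree [n]: then [g] is no codeword, but its residue 0 is. *)
move=> gM /subsetP/(_ (poly_rV (g %% M))) gh hM; move: gh.
by rewrite !inE poly_rV_K ?size_modM // -!dvdp_mod // dvdpp; apply.
Qed.

Lemma eq_polycode g h : g %| M -> h %| M ->
  (polycode g == polycode h) = (g %= h).
Proof.
move=> gM hM; apply/eqP/idP => [eq_gh|eq_gh].
  by apply/andP; split; apply: polycode_sub; rewrite // eq_gh.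
by apply/setP => v; rewrite !inE (eqp_dvdl _ eq_gh).
Qed.

(** Polynomials with residue modulo [M] in [C] form an ideal [J]. Starting from [M] and taking the
    gcd with each codeword in turn stays in [J] by Bezout, and ends with a divisor of [M] dividing
    every codeword. *)
Lemma negacyclic_polycode C : is_linear_code C -> is_negacyclic C ->
  exists2 g, g %| M & C = polycode g.
Proof.
case/and3P=> C0 /forall_inP CD /forallP CZ /forall_inP CX.
pose J p := poly_rV (p %% M) \in C.
have JD p1 p2 : J p1 -> J p2 -> J (p1 + p2).
  by rewrite /J modpD linearD => /CD/forall_inP; apply.
have JZ c p : J p -> J (c *: p).
  by rewrite /J modpZl linearZ => Jp; have /forall_inP := CZ c; apply.
have JX p : J p -> J (p * 'X).
  move=> /CX; rewrite /J; set v := poly_rV _ => Cv.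
  suff -> : poly_rV (p * 'X %% M) = negashift v by [].
  by rewrite -[RHS]rVpolyK rVpoly_negashift poly_rV_K // modp_mul mulrC.
have J0 : J 0 by rewrite /J mod0p linear0.
have JM a p : J p -> J (a * p).
  move=> Jp; elim/poly_ind: a => [|a c IHa]; first by rewrite mul0r.
  by rewrite mulrDl mulrAC mul_polyC JD ?JZ ?JX.
have Jrow v : J (rVpoly v) = (v \in C).
  by rewrite /J modp_small ?rVpolyK // size_M ltnS.
have [g [Jg gM gC]] : exists g, [/\ J g, g %| M
    & {in enum C, forall v, g %| rVpoly v}].
  have: {subset enum C <= C} by move=> v; rewrite mem_enum.
  elim: (enum C) => [|v vs IHvs] sub_C.
    by exists M; split; rewrite // /J modpp linear0.
  have [|g [Jg gM g_vs]] := IHvs.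
    by move=> w vs_w; rewrite sub_C // inE vs_w orbT.
  have [[a b] /= /eqpP[[c1 c2] /= /andP[_ c2_neq0] Dab]] := Bezoutp (rVpoly v) g.
  exists (gcdp (rVpoly v) g); split; last 1 first.
  - move=> w /predU1P[->|/g_vs]; first exact: dvdp_gcdl.
    exact/dvdp_trans/dvdp_gcdr.
  - rewrite -[gcdp _ g]scale1r -(mulVf c2_neq0) -scalerA -Dab.
    by rewrite !JZ // JD ?JM // Jrow sub_C ?mem_head.
  exact: dvdp_trans (dvdp_gcdr _ _) gM.
exists g => //; apply/setP => v; rewrite inE; apply/idP/idP => [Cv|].
  by rewrite gC ?mem_enum.
by case/dvdpP => a Dv; rewrite -Jrow Dv JM.
Qed.

Variable q : nat.
Hypothesis q_char : [pchar F].-nat q.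

(** Reversing the second word turns the form into a convolution, so orthogonality is the vanishing
    of one coefficient of a product. *)
Lemma herm_form_coef (v c : 'rV[F]_n) :
  \sum_(i < n) v 0 i * c 0 i ^+ q = (rVpoly v * crev q n.-1 (rVpoly c))`_n.-1.
Proof.
rewrite coefM prednK //; apply: eq_bigr => i _.
rewrite coef_rVpoly_ord coef_poly ltnS leq_subr subKn ?coef_rVpoly_ord //.
by rewrite -ltnS prednK.
Qed.

Lemma dvdM_coef0 g : g %| M -> g`_0 != 0.
Proof.
case/dvdpP=> a /polyP/(_ 0%N); rewrite coefD coefXn coef1 eqxx coef0M.
rewrite (ltn_eqF n_gt0) add0r => /esym/eqP; apply: contraTneq => ->.
by rewrite mulr0 eq_sym oner_eq0.
Qed.

Lemma crecip_dvdM g : g %| M -> crecip q g %| M.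
Proof.
case/dvdpP=> a DM; rewrite -(crecip_Xn_add1 q_char n_gt0) DM crecipM //.
exact: dvdp_mull.
Qed.

(* [v * crecip g] has degree less than [n + deg g], and orthogonality to the
   shifts ['X^k * g] that need no reduction modulo [M] kills its coefficients
   from [deg g] to [n - 1]. So it is [A + 'X^n * B = M * B + (A - B)] with [A]
   and [B] of degree less than [deg g]; as [crecip g] divides it and [M],
   [A = B]. *)
Lemma herm_dual_polycode g v : g %| M ->
  (v \in herm_dual q (polycode g)) = (M %| rVpoly v * crecip q g).
Proof.
move=> gM; have g0 := dvdM_coef0 gM.
have g_neq0 : g != 0 by apply: contraNneq g0 => ->; rewrite coef0.
have sz_rg := size_crecip q g0.
have sz_g : (0 < size g)%N by rewrite size_poly_gt0.
have le_gn : (size g <= n.+1)%N by rewrite -size_M dvdp_leq.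
have sz_v := size_rVpoly v; have rgM := crecip_dvdM gM.
set d := (size g).-1; have Dd : size g = d.+1 by rewrite prednK.
rewrite inE; apply/forall_inP/idP => [dual_v|Mv c].
  set w := rVpoly v * _.
  have w0 i : (d <= i < n)%N -> w`_i = 0.
    case/andP=> le_di lt_in; have le_in : (i <= n.-1)%N by rewrite -ltnS prednK.
    pose k := (i - d)%N; pose c : 'rV[F]_n := poly_rV ('X^k * g).
    have sz_kg : (size ('X^k * g)%R <= n)%N.
      by rewrite mulrC size_mulXn // Dd addnS subnK.
    have := dual_v c; rewrite inE herm_form_coef poly_rV_K // dvdp_mull //.
    move/(_ isT)/eqP.
    have Dn : n.-1 = ((n.-1 - i + k) + d)%N by rewrite -addnA subnK // subnK.
    rewrite {1}Dn crevM ?size_polyXn ?Dd // ?ltnS ?leq_addl //.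
    rewrite crev_shift ?size_polyXn // crevXn // mulr1 mulrCA coefXnM.
    by rewrite ltnNge leq_subr /= subKn.
  have sz_w : (size w <= n + d)%N.
    apply: leq_trans (size_polyMleq _ _) _; rewrite sz_rg Dd addnS /=.
    by rewrite leq_add2r.
  pose A := take_poly n w; pose B := drop_poly n w.
  have Dw : w = M * B + (A - B).
    by rewrite -{1}(poly_take_drop n w) mulrDl mul1r addrCA addrK mulrC addrC.
  suff /eqP AB0 : A - B == 0 by rewrite Dw AB0 addr0 dvdp_mulr.
  apply: contraTT (_ : crecip q g %| A - B) => [AB_neq0|].
    apply/negP=> /dvdp_leq -/(_ AB_neq0); rewrite sz_rg Dd ltnNge => /negP[].
    apply: leq_trans (size_polyD _ _) _; rewrite size_polyN geq_max.
    apply/andP; split; apply/leq_sizeP => i le_di;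
      rewrite (coef_take_poly, coef_drop_poly).
      by case: ifP => // lt_in; rewrite w0 // le_di.
    by rewrite nth_default // (leq_trans sz_w) // addnC leq_add2r.
  rewrite -(dvdp_addr _ (dvdp_mulr B rgM)) -Dw; exact: dvdp_mull.
rewrite inE => /dvdpP[a Dc]; rewrite herm_form_coef.
have [->|c_neq0] := eqVneq (rVpoly c) 0; first by rewrite crev0 // mulr0 coef0.
have a_neq0 : a != 0 by apply: contraNneq c_neq0; rewrite Dc => ->; rewrite mul0r.
have := size_rVpoly c; rewrite Dc size_mul // Dd addnS /= => sz_a.
have sz_a_gt0 : (0 < size a)%N by rewrite size_poly_gt0.
have Dn : n.-1 = (n.-1 - d + d)%N.
  by rewrite subnK // -ltnS prednK // (leq_trans _ sz_a) // -add1n leq_add2r.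
have: M %| rVpoly v * crev q n.-1 (a * g).
  have sz_a' : (size a <= (n.-1 - d).+1)%N.
    by rewrite -(leq_add2r d) addSn -Dn prednK.
  by rewrite Dn crevM ?Dd // mulrCA dvdp_mull.
(* Below degree [n] the product [b * M] has the coefficients of [b]. Comparing sizes gives
   [size b <= n.-1], so coefficient [n.-1] vanishes. *)
case/dvdpP=> b Db; rewrite Db mulrDr mulr1 coefD coefMXn prednK // leqnn add0r.
apply/eqP/nth_default; have [->|b_neq0] := eqVneq b 0; first by rewrite size_poly0.
have sz_bn : size (rVpoly v * crev q n.-1 (a * g)) = (size b + n)%N.
  by rewrite Db size_mul // size_M addnS.
rewrite -(leq_add2r n) -sz_bn.
apply: leq_trans (size_polyMleq _ _) _.
rewrite -[(_ + n)%N]/(n.-1 + n)%N -subn1 leq_subLR.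
rewrite addnA add1n prednK // leq_add //.
by rewrite (leq_trans (size_poly _ _)) // prednK.
Qed.

(** Writing [M] as [h * crecip q g], the dual is the code of [h], so self-duality says that [g] and
    [h] are associate. *)
Lemma polycode_self_dual g : g %| M ->
  herm_self_dual q (polycode g) = (g * crecip q g %= M).
Proof.
move=> gM; have rgM := crecip_dvdM gM; have [h DM] := dvdpP _ _ rgM.
have rg_neq0 : crecip q g != 0.
  by apply: contraNneq M_neq0; rewrite DM => ->; rewrite mulr0.
have hM : h %| M by rewrite DM dvdp_mulr.
rewrite /herm_self_dual; have -> : herm_dual q (polycode g) = polycode h.
  by apply/setP => v; rewrite herm_dual_polycode // DM dvdp_mul2r // inE.
by rewrite eq_polycode // DM eqp_mul2r.
Qed.

End PolynomialCodes.

(** A nonzero constant term preserves the degree, so the two reversals cancel and only the two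
    [q]-th powers remain. *)
Lemma coef_crecip2 (K : fieldType) q (p : {poly K}) i :
  (0 < q)%N -> p`_0 != 0 ->
  (crecip q (crecip q p))`_i = p`_i ^+ q ^+ q.
Proof.
move=> q_gt0 p0; have sz_p : (0 < size p)%N.
  by rewrite lt0n size_poly_eq0; apply: contraNneq p0 => ->; rewrite coef0.
rewrite {1}/crecip size_crecip // coef_poly prednK //; case: ltnP => [lt_i|le_i].
  rewrite coef_poly ltnS leq_subr subKn //.
  by rewrite -ltnS prednK.
by rewrite nth_default // !expr0n gtn_eqF //= expr0n gtn_eqF.
Qed.

Lemma mup_dvdp (K : fieldType) (x : K) p1 p2 :
  p2 != 0 -> p1 %| p2 -> (mup x p1 <= mup x p2)%N.
Proof.
move=> p2_neq0 p12; rewrite mup_geq // (dvdp_trans _ p12) // -mup_geq //.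
by apply: contraNneq p2_neq0 => p1_0; rewrite p1_0 dvd0p in p12.
Qed.

(** * Polynomials given by root multiplicities *)

Section RootProducts.
Variables (K : fieldType) (T : finType) (u : T -> K).
Hypothesis u_inj : injective u.

Definition rootprod (m : T -> nat) : {poly K} :=
  \prod_(x : T) ('X - (u x)%:P) ^+ m x.

Lemma rootprod_neq0 m : rootprod m != 0.
Proof. by apply/prodf_neq0 => x _; rewrite expf_neq0 ?polyXsubC_eq0. Qed.

Lemma mup_rootprod m x : mup (u x) (rootprod m) = m x.
Proof.
rewrite /rootprod (bigD1 x) //= mupMl ?mup_XsubCX ?eqxx // /root horner_prod.
apply/prodf_neq0 => y neq_yx.
by rewrite horner_exp expf_neq0 // hornerXsubC subr_eq0 (inj_eq u_inj) eq_sym.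
Qed.

Lemma dvdp_rootprod m1 m2 x : rootprod m1 %| rootprod m2 -> (m1 x <= m2 x)%N.
Proof. by move/(mup_dvdp (u x) (rootprod_neq0 m2)); rewrite !mup_rootprod. Qed.

Lemma eqp_rootprod m1 m2 : rootprod m1 %= rootprod m2 -> m1 =1 m2.
Proof.
by move=> /andP[m12 m21] x; apply/eqP; rewrite eqn_leq !dvdp_rootprod.
Qed.

Lemma eq_rootprod m1 m2 : m1 =1 m2 -> rootprod m1 = rootprod m2.
Proof. by move=> eq_m; apply: eq_bigr => x _; rewrite eq_m. Qed.

Lemma rootprodD m1 m2 :
  rootprod m1 * rootprod m2 = rootprod (fun x => m1 x + m2 x)%N.
Proof. by rewrite -big_split; apply: eq_bigr => x _; rewrite exprD. Qed.

Lemma prod_XsubC_rootprod (r : seq K) : {subset r <= codom u} ->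
  exists m, \prod_(z <- r) ('X - z%:P) = rootprod m.
Proof.
elim: r => [|z r IHr] sub_r.
  exists (fun _ => 0)%N; by rewrite big_nil /rootprod big1.
have [y Dz] := codomP (sub_r z (mem_head _ _)).
have [|m Dm] := IHr; first by move=> t r_t; rewrite sub_r // inE r_t orbT.
exists (fun x => (x == y) + m x)%N; rewrite big_cons Dm -rootprodD.
congr (_ * _); rewrite /rootprod (bigD1 y) //= eqxx expr1 Dz big1 ?mulr1 //.
by move=> x /negPf->; rewrite expr0.
Qed.

Section ConjugateReciprocal.
Variables (q : nat) (s t : T -> T).
Hypotheses (q_char : [pchar K].-nat q) (sK : cancel s t) (tK : cancel t s).
Hypotheses (u_neq0 : forall x, u x != 0).
Hypothesis u_s : forall x, u (s x) = (u x ^+ q)^-1.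

Let crecip_prod (F : T -> {poly K}) m :
  crecip q (\prod_x F x ^+ m x) = \prod_x crecip q (F x) ^+ m x.
Proof.
rewrite (big_morph _ (crecipM q_char) (crecip1 q_char)); apply: eq_bigr => x _.
elim: (m x) => [|k IHk]; first by rewrite !expr0 crecip1.
by rewrite !exprS crecipM // IHk.
Qed.

(** The factor X - a becomes 1 - a^q X, an associate of X - a^(-q), so the multiplicity at [x] moves
    to [s x]. *)
Lemma crecip_rootprod m : crecip q (rootprod m) %= rootprod (m \o t).
Proof.
have -> : rootprod (m \o t) = \prod_x ('X - (u (s x))%:P) ^+ m x.
  rewrite /rootprod (reindex s); last by exists t => x _.
  by apply: eq_bigr => x _; rewrite /= sK.
rewrite crecip_prod.
apply: (big_ind2 (fun a b => a %= b)) => [|a b c d|x _].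
- exact: eqpxx.
- by move=> ab cd; apply: eqp_trans (eqp_mulr _ ab) (eqp_mull _ cd).
apply: eqp_exp; rewrite crecip_XsubC // u_s.
have uq_neq0 : u x ^+ q != 0 by rewrite expf_neq0.
suff -> : 1 - (u x ^+ q) *: 'X = - (u x ^+ q) *: ('X - ((u x ^+ q)^-1)%:P).
  by apply: eqp_scale; rewrite oppr_eq0.
rewrite scalerBr -[_ *: _%:P]mul_polyC -polyCM mulNr divff //.
by rewrite polyCN opprK scaleNr addrC.
Qed.

(** Applying [crecip] twice raises coefficients to the power q^2. It also sends each root [u x] to
    [u (s (s x))], which only permutes the factors when [m] is invariant. *)
Lemma rootprod_coef_fixed m i : m \o (s \o s) =1 m ->
  (rootprod m)`_i ^+ q ^+ q = (rootprod m)`_i.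
Proof.
move=> m_ss; have q_gt0 : (0 < q)%N by case/andP: q_char.
have XsubC0 x : ('X - (u x)%:P)`_0 != 0.
  by rewrite coefB coefX coefC sub0r oppr_eq0.
have G0 : (rootprod m)`_0 != 0.
  rewrite -horner_coef0 horner_prod; apply/prodf_neq0 => x _.
  by rewrite horner_exp horner_coef0 expf_neq0.
rewrite -coef_crecip2 // !crecip_prod.
have ss_inj : injective (s \o s) by apply: inj_comp; apply: can_inj sK.
have -> : rootprod m = \prod_x ('X - (u (s (s x)))%:P) ^+ m x.
  rewrite /rootprod (reindex_inj ss_inj).
  by apply: eq_bigr => x _; rewrite -[in RHS](m_ss x).
congr (nth _ (polyseq _) _); apply: eq_bigr => x _; congr (_ ^+ _).
apply/polyP => k; rewrite coef_crecip2 // !u_s exprVn invrK.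
rewrite !coefB !coefX !coefC; case: k => [|[|k]] /=.
- by rewrite !sub0r !exprNn_pchar.
- by rewrite !subr0 !expr1n.
by rewrite subr0 !expr0n gtn_eqF //= expr0n gtn_eqF.
Qed.

End ConjugateReciprocal.
End RootProducts.

(** Over [F], X^#|F| - X is the product of all X - c, so its roots in [K] are images of elements of
    [F]. *)
Lemma finField_fixed_range (F : finFieldType) (K : fieldType)
  (f : {rmorphism F -> K}) (a : K) : a ^+ #|F| = a -> exists c, f c = a.
Proof.
move=> aF; have: root (map_poly f ('X^#|F| - 'X)) a.
  rewrite rmorphB /= map_polyXn map_polyX.
  by rewrite /root hornerD hornerN hornerXn hornerX aF subrr.
rewrite finField_genPoly rmorph_prod /root horner_prod => /eqP/eqP.
case/prodf_eq0 => c _; rewrite rmorphB /= map_polyX map_polyC hornerXsubC.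
by rewrite subr_eq0 eq_sym => /eqP <-; exists c.
Qed.

(** * Self-dual codes correspond to alternating multiplicity functions *)

Section SelfDualCodes.
Variables (F : finFieldType) (K : closedFieldType) (f : {rmorphism F -> K}).
Variables (q n P : nat) (T : finType) (u : T -> K) (s t : T -> T).
Hypotheses (n_gt0 : (0 < n)%N) (q_char : [pchar F].-nat q).
Hypothesis cardF : #|F| = (q * q)%N.
Hypotheses (u_inj : injective u) (u_neq0 : forall x, u x != 0).
Hypotheses (sK : cancel s t) (tK : cancel t s).
Hypothesis u_s : forall x, u (s x) = (u x ^+ q)^-1.
Hypothesis fM : map_poly f ('X^n + 1) = rootprod u (fun _ => P).

Let q_charK : [pchar K].-nat q.
Proof. by rewrite (eq_pnat _ (fmorph_pchar f)). Qed.

Local Notation M := ('X^n + 1 : {poly F}).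

Lemma rootprod_descent m : m \o (s \o s) =1 m ->
  exists g : {poly F}, map_poly f g = rootprod u m.
Proof.
move=> m_ss; set G := rootprod u m.
(* The default 0 is never taken: each coefficient of [G] is fixed by the power #|F| = q^2, hence has
   a preimage. *)
exists (\poly_(i < size G) odflt 0 [pick c | f c == G`_i]).
apply/polyP => i; rewrite coef_map coef_poly /=.
case: ltnP => [_|le_i]; last by rewrite rmorph0 nth_default.
case: pickP => [c /eqP //|no_c].
have [|c fc] := @finField_fixed_range F K f G`_i; last first.
  by have := no_c c; rewrite /= fc eqxx.
by rewrite cardF exprM (rootprod_coef_fixed q_charK sK).
Qed.

Lemma dvdM_rootprod g : g %| M ->
  exists2 m : T -> nat, map_poly f g %= rootprod u m & forall x, (m x <= P)%N.
Proof.
move=> gM; have fgM : map_poly f g %| rootprod u (fun _ => P).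
  by rewrite -fM dvdp_map.
have [r Dg] := closed_field_poly_normal (map_poly f g).
have lc_neq0 : lead_coef (map_poly f g) != 0.
  rewrite lead_coef_eq0; apply: contraTneq fgM => ->.
  by rewrite dvd0p rootprod_neq0.
have [|m Dm] := @prod_XsubC_rootprod _ _ u r.
  move=> z r_z; have: root (rootprod u (fun _ => P)) z.
    rewrite -dvdp_XsubCl (dvdp_trans _ fgM) // Dg dvdp_XsubCl rootZ //.
    by rewrite root_prod_XsubC.
  rewrite /root horner_prod => /eqP/eqP; case/prodf_eq0 => x _.
  rewrite horner_exp hornerXsubC expf_eq0 subr_eq0 => /andP[_ /eqP ->].
  exact: codom_f.
have eq_gm : map_poly f g %= rootprod u m by rewrite Dg Dm eqp_scale.
exists m => // x; rewrite (eqp_dvdl _ eq_gm) in fgM.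
exact: (dvdp_rootprod u_inj x fgM).
Qed.

Lemma eqp_self_dual_rootprod g m : map_poly f g %= rootprod u m ->
  (g * crecip q g %= M) <-> (forall x, m x + m (s x) = P)%N.
Proof.
move=> eq_gm.
(* Associates have equal size, so they are reversed at the same length and their scalars just become
   [q]-th powers. *)
have eq_gm' : crecip q (map_poly f g) %= rootprod u (m \o t).
  have := crecip_rootprod q_charK sK tK u_neq0 u_s m.
  apply: eqp_trans; case/eqpP: eq_gm => -[c1 c2] /= /andP[c1_neq0 c2_neq0] Dg.
  apply/eqpP; exists (c1 ^+ q, c2 ^+ q); rewrite /= ?expf_neq0 //.
  have sz : size (map_poly f g) = size (rootprod u m).
    by rewrite -(size_scale _ c1_neq0) Dg size_scale.
  by rewrite /crecip -!crevZ // Dg sz.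
rewrite -(eqp_map f) rmorphM /= map_crecip fM.
have eq_gg : map_poly f g * crecip q (map_poly f g)
    %= rootprod u (fun x => m x + (m \o t) x)%N.
  by rewrite -rootprodD; apply: eqp_trans (eqp_mulr _ eq_gm) (eqp_mull _ eq_gm').
rewrite (eqp_ltrans eq_gg); split=> [/(eqp_rootprod u_inj) eqP x|eqP].
  by rewrite -(eqP (s x)) /= sK addnC.
rewrite (@eq_rootprod _ _ u _ (fun _ => P)) ?eqpxx // => x.
by rewrite -(eqP (t x)) tK addnC.
Qed.

Lemma NH_alternating : NH F n q =
  #|[set m : {ffun T -> 'I_P.+1} | [forall x, m x + m (s x) == P :> nat]%N]|.
Proof.
pose e (m : {ffun T -> 'I_P.+1}) (x : T) : nat := m x.
(* Divisibility is tested over [K], so [Phi] needs no choice of a generator over [F]. *)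
pose Phi (m : {ffun T -> 'I_P.+1}) : {set 'rV[F]_n} :=
  [set v | rootprod u (e m) %| map_poly f (rVpoly v)].
set S := [set m | _].
have PhiE m g : map_poly f g %= rootprod u (e m) -> Phi m = polycode n g.
  by move=> eq_gm; apply/setP => v; rewrite !inE -(eqp_dvdl _ eq_gm) dvdp_map.
have SP (m : {ffun T -> 'I_P.+1}) :
    reflect (forall x, m x + m (s x) = P)%N (m \in S).
  by rewrite inE; apply: (iffP forallP) => mP x; apply/eqP/mP.
have gen m : m \in S ->
    exists g, [/\ map_poly f g = rootprod u (e m), g %| M & Phi m = polycode n g].
  move=> /SP mP; have [x|g Dg] := @rootprod_descent (e m).
    (* Both [m x] and [m (s (s x))] complement [m (s x)] to [P]; this invariance permits descent to
       [F]. *)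
    by apply: (@addIn (m (s x))); rewrite mP /= /e addnC mP.
  exists g; split=> //; last by rewrite (PhiE m g) // Dg eqpxx.
  rewrite -(dvdp_map f) fM Dg.
  have <- : rootprod u (fun x => e m x + e m (s x))%N = rootprod u (fun=> P).
    by apply: eq_rootprod => x; apply: mP.
  by rewrite -rootprodD dvdp_mulr.
rewrite -(@card_in_imset _ _ Phi) => [|m1 m2 Sm1 Sm2 eq_Phi].
  apply: eq_card => C; rewrite inE; apply/idP/imsetP.
    case/and3P => linC negC.
    have [g gM ->] := negacyclic_polycode n_gt0 linC negC.
    rewrite polycode_self_dual // => dual_g.
    have [m eq_gm le_mP] := dvdM_rootprod gM.
    pose m' := [ffun x => inord (m x) : 'I_P.+1].
    have m'E x : e m' x = m x by rewrite /e ffunE inordK // ltnS.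
    have eq_gm' : map_poly f g %= rootprod u (e m').
      by rewrite (@eq_rootprod _ _ u _ m m'E).
    exists m'; last by rewrite (PhiE m' g).
    by apply/SP; apply/(eqp_self_dual_rootprod eq_gm').
  case=> m Sm ->; have [g [Dg gM ->]] := gen m Sm.
  rewrite polycode_linear polycode_negacyclic // polycode_self_dual //=.
  by apply/(@eqp_self_dual_rootprod g (e m)); [rewrite Dg eqpxx|apply/SP].
have [g1 [Dg1 g1M eq1]] := gen m1 Sm1; have [g2 [Dg2 g2M eq2]] := gen m2 Sm2.
have := eqxx (Phi m1); rewrite {2}eq_Phi eq1 eq2 eq_polycode //.
rewrite -(eqp_map f) Dg1 Dg2 => /(eqp_rootprod u_inj) eq_m.
by apply/ffunP => x; apply/val_inj/eq_m.
Qed.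

End SelfDualCodes.

(** * Divisibility of q^k + 1 by powers of two, and multiplicative orders *)

Lemma odd_exp_add1_factor q j : odd q ->
  exists2 c, odd c & (q ^ j.*2.+1 + 1 = (q + 1) * c)%N.
Proof.
case: q => // q /= even_q; elim: j => [|j [c odd_c Dc]].
  by exists 1%N; rewrite // expn1 muln1.
(* Here [q.+1] is the original base b, and b^(2j+3) + 1 = (b^(2j+1) + 1) + b^(2j+1) (b - 1)(b + 1).
   The added cofactor is even because b - 1 is. *)
exists (c + q * q.+1 ^ j.*2.+1)%N.
  by rewrite oddD oddM odd_c (negPf even_q).
rewrite mulnDr -Dc doubleS 2!expnS; set A := (_ ^ _)%N.
lia.
Qed.

Lemma dvdn_exp_odd_add1 a q k : odd q -> odd k ->
  (2 ^ a %| q ^ k + 1)%N -> (2 ^ a %| q + 1)%N.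
Proof.
move=> odd_q odd_k; rewrite -(odd_double_half k) odd_k add1n.
have [c odd_c ->] := odd_exp_add1_factor k./2 odd_q.
by rewrite Gauss_dvdl // coprimeXl // coprime2n.
Qed.

(** By Euler's theorem [totient m], which is at most [m], is in the filtered list; the list is
    sorted, so its head is the least exponent. *)
Lemma ordmP m x : (0 < m)%N -> coprime m x ->
  [/\ (0 < ordm m x)%N, (x ^ ordm m x = 1 %[mod m])%N
    & forall k, (0 < k)%N -> (x ^ k = 1 %[mod m])%N -> (ordm m x <= k)%N].
Proof.
move=> m_gt0 co_mx; rewrite /ordm; set s := filter _ _.
have s_mem k : (k \in s) = [&& (x ^ k == 1 %[mod m])%N, 0 < k & k <= m]%N.
  by rewrite mem_filter mem_iota add1n ltnS.
have s_tot : totient m \in s.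
  rewrite s_mem totient_gt0 m_gt0 Euler_exp_totient 1?coprime_sym // eqxx /=.
  rewrite totient_count_coprime big_mkord -[X in (_ <= X)%N]card_ord -sum1_card.
  by apply: leq_sum => i _; case: (coprime _ _).
have: sorted leq s.
  by rewrite sorted_filter ?iota_sorted //; apply: leq_trans.
case Ds: s s_tot => [//|k0 s'] _ /= sorted_s.
have := s_mem k0; rewrite Ds mem_head => /esym/and3P[/eqP xk0 k0_gt0 k0_le].
split=> // k k_gt0 xk; have [le_km|/ltnW lt_mk] := leqP k m; last first.
  exact: leq_trans lt_mk.
have: k \in s by rewrite s_mem xk eqxx k_gt0.
rewrite Ds => /predU1P[-> //|s'k].
by have /allP := order_path_min leq_trans sorted_s; apply.
Qed.

(** * Primitive roots of unity *)

Section PrimitiveRoots.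
Variable K : fieldType.

Lemma prim_root_inj m1 m2 (z : K) :
  m1.-primitive_root z -> m2.-primitive_root z -> m1 = m2.
Proof.
move=> z1 z2; apply/eqP; rewrite eqn_dvd (prim_order_dvd z1) (prim_order_dvd z2).
by rewrite (prim_expr_order z1) (prim_expr_order z2) eqxx.
Qed.

Lemma eq_prim_root m (z w : K) : (forall k, (z ^+ k == 1) = (w ^+ k == 1)) ->
  m.-primitive_root z = m.-primitive_root w.
Proof.
move=> eq_zw; congr (_ && _); apply: eq_forallb => i.
by rewrite !unity_rootE eq_zw.
Qed.

Lemma count_prim_roots m (z : K) (r : seq K) : m.-primitive_root z ->
  uniq r -> (forall w, m.-primitive_root w -> w \in r) ->
  count (primitive_root_of_unity m) r = totient m.
Proof.
move=> prim_z uniq_r sub_r; rewrite -size_filter.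
pose l := [seq z ^+ k | k : 'I_m in [pred k : 'I_m | coprime k m]].
have -> : totient m = size l.
  rewrite size_map -cardE totient_count_coprime big_mkord -sum1_card.
  rewrite [RHS]big_mkcond; apply: eq_bigr => k _.
  by rewrite inE coprime_sym; case: coprime.
apply/perm_size/uniq_perm; first exact: filter_uniq.
  rewrite map_inj_in_uniq ?enum_uniq // => i j _ _ /eqP.
  by rewrite (eq_prim_root_expr prim_z) !modn_small // => /eqP/val_inj.
move=> w; rewrite mem_filter; apply/andP/imageP => [[prim_w _]|[k co_k ->]].
  have [k Dw] := prim_rootP prim_z (prim_expr_order prim_w).
  by exists k; rewrite // inE -(prim_root_exp_coprime _ prim_z) -Dw.
have prim_zk : m.-primitive_root (z ^+ k) by rewrite prim_root_exp_coprime.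
by rewrite sub_r.
Qed.

Lemma expr_pchar_inj q : [pchar K].-nat q -> injective (fun x : K => x ^+ q).
Proof.
move=> q_char x y /eqP; rewrite -subr_eq0 -exprNn_pchar // -exprDn_pchar //.
by rewrite expf_eq0 subr_eq0 => /andP[_ /eqP].
Qed.

End PrimitiveRoots.

(** X^m - 1 is separable, so it has [m] distinct roots, and these include a primitive one. *)
Lemma closed_prim_root (K : closedFieldType) m :
  m%:R != 0 :> K -> exists z : K, m.-primitive_root z.
Proof.
move=> m_neq0; have m_gt0 : (0 < m)%N.
  by rewrite lt0n; apply: contraNneq m_neq0 => ->.
have [r Dr] := closed_field_poly_normal ('X^m - 1 : {poly K}).
rewrite (monicP _) ?monicXnsubC // scale1r in Dr.
have r1 : all m.-unity_root r by apply/allP=> z; rewrite -root_prod_XsubC -Dr.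
have sz_r: (m < (size r).+1)%N.
  by rewrite -(size_prod_XsubC r id) -Dr size_XnsubC.
have [|z] := hasP (has_prim_root m_gt0 r1 _ sz_r); last by exists z.
by rewrite -separable_prod_XsubC -Dr separable_Xn_sub_1.
Qed.

Lemma big_seq_sub (R : Type) (idx : R) (op : Monoid.com_law idx)
    (I : choiceType) (r : seq I) (F : I -> R) : uniq r ->
  \big[op/idx]_(x : seq_sub r) F (val x) = \big[op/idx]_(z <- r) F z.
Proof.
move=> uniq_r; rewrite -(big_map val xpredT F).
apply/perm_big/uniq_perm => //.
  by rewrite (map_inj_uniq val_inj) /index_enum -enumT enum_uniq.
move=> z; apply/mapP/idP => [[x _ ->]|r_z]; first exact: valP.
by exists (SeqSub r_z); rewrite ?mem_index_enum.
Qed.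

Lemma card_seq_sub_count (I : choiceType) (r : seq I) (a : pred I) : uniq r ->
  #|[pred x : seq_sub r | a (val x)]| = count a r.
Proof.
move=> uniq_r; rewrite -sum1_count -sum1_card big_mkcond /=.
by rewrite [RHS]big_mkcond -[RHS]big_seq_sub.
Qed.

(** The odd part of [e] divides [n'] in any case, so the second condition excludes a 2-adic
    valuation of [nu] or less. *)
Lemma dvdn_double_odd_part nu n' e : odd n' ->
  (e %| 2 ^ nu.+1 * n')%N -> ~~ (e %| 2 ^ nu * n')%N ->
  exists2 d, (d %| n')%N & e = (d * 2 ^ nu.+1)%N.
Proof.
move=> odd_n' e_dv e_ndv; have n'_gt0 := odd_gt0 odd_n'.
have e_gt0 : (0 < e)%N by rewrite (dvdn_gt0 _ e_dv) // muln_gt0 expn_gt0.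
have De : e = (2 ^ logn 2 e * e`_2^')%N by rewrite -p_part partnC.
have odd_e' : odd (e`_2^')%N.
  by have := part_pnat (2^')%N e; rewrite p'natE // dvdn2 negbK.
have e'_dv : (e`_2^' %| n')%N.
  rewrite -(@Gauss_dvdr _ (2 ^ nu.+1)) ?coprimeXr ?coprimen2 //.
  exact: dvdn_trans (dvdn_part _ _) e_dv.
have le_a : (logn 2 e <= nu.+1)%N.
  rewrite -(@dvdn_Pexp2l 2) // -(@Gauss_dvdl _ _ n') ?coprimeXl ?coprime2n //.
  by apply: dvdn_trans e_dv; rewrite -p_part dvdn_part.
exists (e`_2^')%N => //; rewrite mulnC {1}De; congr (2 ^ _ * _)%N.
apply/eqP; rewrite eqn_leq le_a ltnNge; apply: contra e_ndv => le_a'.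
by rewrite De dvdn_mul // dvdn_exp2l.
Qed.

(** * The roots of X^n0 + 1 and the orbits of z -> z^(-q) *)

Section NegacyclicRoots.
Variables (K : closedFieldType) (p nu n' l : nat).
Hypotheses (p_pr : prime p) (odd_p : odd p) (p_char : p \in [pchar K]).
Hypotheses (odd_n' : odd n') (p_n' : ~~ (p %| n')%N).

Local Notation n0 := (2 ^ nu * n')%N.
Local Notation q := (p ^ l)%N.

Let n'_gt0 : (0 < n')%N. Proof. exact: odd_gt0. Qed.
Let n0_gt0 : (0 < n0)%N. Proof. by rewrite muln_gt0 expn_gt0. Qed.

Let p'_2exp k : ~~ (p %| 2 ^ k)%N.
Proof. by rewrite -prime_coprime // coprimeXr // coprimen2. Qed.

Let p'_dvd d k : (d %| n')%N -> ~~ (p %| d * 2 ^ k)%N.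
Proof.
move=> d_n'; rewrite Euclid_dvdM // negb_or p'_2exp andbT.
by rewrite (contra _ p_n') // => /dvdn_trans->.
Qed.

Let q_char : [pchar K].-nat q.
Proof. by rewrite pnatX pnatE // p_char. Qed.

Let odd_q : odd q. Proof. by rewrite oddX odd_p orbT. Qed.

Let neg1_neq1 : -1 != 1 :> K.
Proof.
rewrite eq_sym -addr_eq0 -[1 + 1]/(2%:R) -(dvdn_pcharf p_char).
exact: (p'_2exp 1).
Qed.

(** X^n0 + 1 divides X^(2 n0) - 1, which is separable because [p] does not divide 2 n0. *)
Lemma negacyclic_roots :
  exists2 r : seq K, uniq r & 'X^n0 + 1 = \prod_(z <- r) ('X - z%:P).
Proof.
have [r Dr] := closed_field_poly_normal ('X^n0 + 1 : {poly K}).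
rewrite (monicP _) ?monicXnaddC // scale1r in Dr; exists r => //.
rewrite -separable_prod_XsubC -Dr.
have: separable_poly ('X^(n' * 2 ^ nu.+1) - 1 : {poly K}).
  by apply: separable_Xn_sub_1; rewrite -(dvdn_pcharf p_char) p'_dvd.
have -> : 'X^(n' * 2 ^ nu.+1) - 1 = ('X^n0 - 1) * ('X^n0 + 1) :> {poly K}.
  by rewrite -subr_sqr expr1n -exprM expnSr mulnCA mulnA.
by rewrite separable_mul => /and3P[].
Qed.

Variable r : seq K.
Hypotheses (uniq_r : uniq r) (r_mem : forall z, (z \in r) = (z ^+ n0 == -1)).

Local Notation T := (seq_sub r).

Lemma prim_root_mem d z : (d %| n')%N ->
  (d * 2 ^ nu.+1).-primitive_root z -> z \in r.
Proof.
move=> d_n' prim_z; have: (z ^+ n0) ^+ 2 == 1.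
  rewrite -exprM -(prim_order_dvd prim_z) mulnAC -expnSr mulnC.
  by rewrite dvdn_mul.
rewrite sqrf_eq1 r_mem -(prim_order_dvd prim_z) => /orP[] //.
rewrite expnS mulnA mulnC dvdn_pmul2l ?expn_gt0 //.
move/(dvdn_trans (dvdn_mull d (dvdnn 2))).
by rewrite dvdn2 odd_n'.
Qed.

Lemma mem_prim_root z : z \in r ->
  exists2 d, (d %| n')%N & (d * 2 ^ nu.+1).-primitive_root z.
Proof.
rewrite r_mem => /eqP z_n0; have z_2n0 : z ^+ (2 ^ nu.+1 * n') = 1.
  by rewrite expnS -mulnA mulnC exprM z_n0 sqrrN expr1n.
have [|e prim_z e_dv] := prim_order_exists _ z_2n0.
  by rewrite muln_gt0 expn_gt0.
have [|d d_n' De] := dvdn_double_odd_part odd_n' e_dv; last first.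
  by exists d; rewrite -?De.
by rewrite (prim_order_dvd prim_z) z_n0.
Qed.

Let r_neq0 (x : T) : val x != 0.
Proof.
have [d _ prim_x] := mem_prim_root (valP x).
by rewrite (prim_root_eq0 prim_x) -lt0n (prim_order_gt0 prim_x).
Qed.

(* The map [z |-> z^(-q)], whose square is the Frobenius map of the field with
   [q^2] elements. *)
Definition conjroot (x : T) : T := insubd x ((val x ^+ q)^-1).

Lemma val_conjroot x : val (conjroot x) = (val x ^+ q)^-1.
Proof.
rewrite val_insubd r_mem exprVn exprAC; have := valP x; rewrite r_mem => /eqP ->.
by rewrite -signr_odd odd_q expr1 invrN invr1 eqxx.
Qed.

Lemma conjroot_inj : injective conjroot.
Proof.
move=> x y /(congr1 val); rewrite !val_conjroot => /invr_inj.
by move/(expr_pchar_inj q_char)/val_inj.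
Qed.

Lemma val_iter_conjroot k x : val (iter k conjroot x) =
  if odd k then (val x ^+ (q ^ k))^-1 else val x ^+ (q ^ k).
Proof.
elim: k => [|k IHk]; first by rewrite expn0 expr1.
rewrite iterS val_conjroot IHk expnSr exprM /=.
by case: (odd k); rewrite //= exprVn invrK.
Qed.

(** A primitive root of order 2^(nu+1), the case d = 1, satisfies z^(q+1) = 1. *)
Lemma conjroot_fixed : (2 ^ nu.+1 %| q + 1)%N -> exists x, conjroot x = x.
Proof.
move=> dvd_q; have [|z prim_z] := @closed_prim_root K (1 * 2 ^ nu.+1).
  by rewrite -(dvdn_pcharf p_char) p'_dvd // dvd1n.
have r_z : z \in r by apply: prim_root_mem prim_z; rewrite dvd1n.
exists (SeqSub r_z); apply: val_inj; rewrite val_conjroot /=.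
have z_neq0 : z != 0 := r_neq0 (SeqSub r_z).
apply: (@mulIf _ (z ^+ q)); first by rewrite expf_neq0.
rewrite mulVf ?expf_neq0 // -exprS -addn1; apply/esym/eqP.
by rewrite -(prim_order_dvd prim_z) mul1n.
Qed.

Hypothesis ndvd_q : ~~ (2 ^ nu.+1 %| q + 1)%N.

Lemma odd_iter_conjroot k x : odd k -> iter k conjroot x != x.
Proof.
move=> odd_k; apply: contra ndvd_q => /eqP/(congr1 val).
rewrite val_iter_conjroot odd_k => Dx.
have [d _ prim_x] := mem_prim_root (valP x).
apply: (@dvdn_exp_odd_add1 nu.+1 q k) => //.
apply: (@dvdn_trans (d * 2 ^ nu.+1)); first exact: dvdn_mull.
by rewrite (prim_order_dvd prim_x) exprD expr1 -{2}Dx divff // expf_neq0.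
Qed.

Lemma conjroot_order_even x : ~~ odd (order conjroot x).
Proof.
apply/negP => /(odd_iter_conjroot x); rewrite iter_order ?eqxx //.
exact: conjroot_inj.
Qed.

(** The iterate 2j is the power q^(2j), which fixes [x] iff (q^2)^j is 1 modulo the order of [x];
    odd iterates fix nothing. *)
Lemma conjroot_order d x : (d %| n')%N ->
  (d * 2 ^ nu.+1).-primitive_root (val x) ->
  order conjroot x = (2 * ordm (d * 2 ^ nu.+1) (p ^ (2 * l)))%N.
Proof.
set e := (d * _)%N => d_n' prim_x; have e_gt0 := prim_order_gt0 prim_x.
have co_e : coprime e (p ^ (2 * l)).
  by rewrite coprimeXr // coprime_sym prime_coprime // p'_dvd.
have [o_gt0 o_1 o_min] := ordmP e_gt0 co_e.
set o := ordm _ _ in o_gt0 o_1 o_min *.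
have iterE j : (iter (2 * j) conjroot x == x)
    = ((p ^ (2 * l)) ^ j == 1 %[mod e])%N.
  rewrite -(inj_eq val_inj) val_iter_conjroot oddM /=.
  rewrite -[X in _ == X]expr1 (eq_prim_root_expr prim_x).
  by rewrite -!expnM mulnCA mulnA.
have ord_gt0 : (0 < order conjroot x)%N by rewrite -orderSpred.
apply/eqP; rewrite eqn_leq; apply/andP; split.
  rewrite leqNgt; apply/negP => lt_o; have := findex_iter lt_o.
  have /eqP-> : iter (2 * o) conjroot x == x by rewrite iterE; apply/eqP.
  by rewrite findex0 => /esym/eqP; rewrite muln_eq0 /= gtn_eqF.
have D2 : order conjroot x = (2 * (order conjroot x)./2)%N.
  by rewrite mul2n even_halfK ?conjroot_order_even.
rewrite D2 leq_pmul2l // o_min //.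
  by rewrite -(@ltn_pmul2l 2) // -D2.
apply/eqP; rewrite -iterE -D2 iter_order ?eqxx //; exact: conjroot_inj.
Qed.

Let has_order d := [pred x : T | (d * 2 ^ nu.+1).-primitive_root (val x)].

Lemma has_order_closed d : fclosed conjroot (has_order d).
Proof.
move=> x y /eqP <-; rewrite !inE; apply: eq_prim_root => k.
rewrite val_conjroot exprVn invr_eq1 exprAC -[in RHS](expr1n _ q).
by rewrite (inj_eq (expr_pchar_inj q_char)).
Qed.

Lemma sum_divisors_has_order x :
  (\sum_(d <- divisors n') has_order d x = 1)%N.
Proof.
have [d0 d0_n' prim_x] := mem_prim_root (valP x).
transitivity (count_mem d0 (divisors n')); last first.
  by rewrite count_uniq_mem ?divisors_uniq // -dvdn_divisors // d0_n'.
rewrite -sum1_count [RHS]big_mkcond; apply: eq_bigr => d _ /=.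
case: eqP => [->|ne_d]; first by rewrite prim_x.
case: (boolP (_.-primitive_root _)) => // /(prim_root_inj prim_x)/eqP.
by rewrite eqn_pmul2r ?expn_gt0 // => /eqP/esym.
Qed.

Lemma fcard_conjroot : fcard conjroot {: T} =
  ((\sum_(d <- divisors n')
      totient (d * 2 ^ nu.+1) %/ ordm (d * 2 ^ nu.+1) (p ^ (2 * l))) %/ 2)%N.
Proof.
have -> : fcard conjroot {: T}
    = (\sum_(d <- divisors n') fcard conjroot (has_order d))%N.
  rewrite /n_comp_mem -sum1_card big_mkcond /=.
  under [RHS]eq_bigr => d _ do rewrite -sum1_card big_mkcond /=.
  rewrite exchange_big /=; apply: eq_bigr => x _; rewrite inE andbT.
  under eq_bigr => d _ do rewrite !inE.
  case: (froots _ x); last by rewrite big1.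
  by rewrite -[LHS](sum_divisors_has_order x); apply: eq_bigr => d _ /=;
    case: (_.-primitive_root _).
(* Each quotient of [totient] by [ordm] is exactly twice the number of orbits in its class, so both
   integer divisions are exact. *)
rewrite [in RHS](eq_big_seq (fun d => fcard conjroot (has_order d) * 2)%N).
  by rewrite -big_distrl mulnK.
move=> d; rewrite -dvdn_divisors // => d_n'; set e := (d * _)%N.
have [|z prim_z] := @closed_prim_root K e.
  by rewrite -(dvdn_pcharf p_char) p'_dvd.
have o_gt0 : (0 < ordm e (p ^ (2 * l)))%N.
  have [] // := @ordmP e (p ^ (2 * l)); first exact: prim_order_gt0 prim_z.
  by rewrite coprimeXr // coprime_sym prime_coprime // p'_dvd.
rewrite -(count_prim_roots prim_z uniq_r) => [|w]; last exact: prim_root_mem.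
rewrite -card_seq_sub_count // -[#|_|]/#|has_order d|.
rewrite -(fcard_order_set conjroot_inj _ (has_order_closed d)
           (n := 2 * ordm e (p ^ (2 * l)))); last first.
  by apply/subsetP => x; rewrite !inE => /(conjroot_order d_n') ->.
by rewrite mulnA mulnK.
Qed.

End NegacyclicRoots.

(** * The count of Hermitian self-dual negacyclic codes *)

Theorem theorem3p15 (p nu r n' l : nat) (F : finFieldType) :
  prime p -> odd p ->
  (0 < nu)%N -> odd n' -> (0 < n')%N -> ~~ (p %| n')%N ->
  (0 < l)%N ->
  #|F| = (p ^ (2 * l))%N ->
  NH F (2 ^ nu * p ^ r * n') (p ^ l) =
    (if ~~ (2 ^ nu.+1 %| p ^ l + 1)%N then
       ((p ^ r + 1) ^
          ((\sum_(d <- divisors n')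
               (totient (d * 2 ^ nu.+1) %/ ordm (d * 2 ^ nu.+1) (p ^ (2 * l))))
           %/ 2))%N
     else 0%N).
Proof.
move=> p_pr odd_p _ odd_n' n'_gt0 p_n' _ cardF.
have p_charF : p \in [pchar F] by apply: card_finPcharP cardF p_pr.
have [K [f _]] := countable_algebraic_closure F.
have p_charK : p \in [pchar K] by rewrite (fmorph_pchar f).
have p_natF k : [pchar F].-nat (p ^ k)%N by rewrite pnatX pnatE // p_charF.
have [rs uniq_rs Drs] := negacyclic_roots nu p_pr odd_p p_charK odd_n' p_n'.
have rs_mem z : (z \in rs) = (z ^+ (2 ^ nu * n') == -1).
  by rewrite -root_prod_XsubC -Drs /root hornerD hornerXn hornerC addr_eq0.
pose s := @conjroot K p l rs.
have val_s x : val (s x) = (val x ^+ (p ^ l))^-1.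
  by apply: val_conjroot rs_mem x.
have s_inj : injective s by apply: conjroot_inj rs_mem.
have n_gt0 : (0 < 2 ^ nu * p ^ r * n')%N.
  by rewrite !muln_gt0 !expn_gt0 (prime_gt0 p_pr) n'_gt0.
have rs_neq0 (x : seq_sub rs) : val x != 0.
  have := valP x; rewrite rs_mem; apply: contraTneq => ->.
  by rewrite expr0n gtn_eqF ?muln_gt0 ?expn_gt0 //= eq_sym oppr_eq0 oner_eq0.
(* In characteristic [p] the polynomial is (X^n0 + 1)^(p^r), so every root has multiplicity
   [p ^ r]. *)
have fM : map_poly f ('X^(2 ^ nu * p ^ r * n') + 1)
    = rootprod (val : seq_sub rs -> K) (fun=> p ^ r)%N.
  rewrite rmorphD rmorph1 /= map_polyXn mulnAC exprM.
  rewrite -[X in _ + X](expr1n _ (p ^ r)) -exprDn_pchar; last first.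
    by rewrite (eq_pnat _ (pchar_poly _)) pnatX pnatE // p_charK.
  rewrite Drs -prodrXl /rootprod.
  by rewrite -(big_seq_sub _ (fun z => ('X - z%:P) ^+ _)).
rewrite (@NH_alternating F K f _ _ (p ^ r) _ val s (finv s)) //; first last.
- exact: f_finv.
- exact: finv_f.
- exact: val_inj.
- by rewrite cardF -expnD mul2n addnn.
have [dvd_q|ndvd_q] /= := boolP (2 ^ nu.+1 %| p ^ l + 1)%N.
  have [x sx] := conjroot_fixed p_pr odd_p p_charK odd_n' p_n' rs_mem dvd_q.
  (* At a fixed point the condition reads 2 m(x) = p^r, impossible by parity. *)
  apply: eq_card0 => m; rewrite !inE; apply/forallP => /(_ x).
  rewrite /s sx addnn => /eqP/(congr1 odd).
  by rewrite odd_double oddX odd_p orbT.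
rewrite card_alternating_ffun //; last first.
  by move=> x; apply: conjroot_order_even rs_mem ndvd_q x.
rewrite addn1; congr (_ ^ _)%N.
exact: (fcard_conjroot p_pr odd_p p_charK odd_n' p_n' uniq_rs rs_mem ndvd_q).
Qed.
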